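(* Let $X$ be a Banach space. Then $X$ has property $(sO)$ if and only if $X$ is finite dimensional or satisfies $\bar{\delta}_X(x,t)>t-1$ for every $t\geq 1$ and every $x\in S_X$.
   Context: The scalar field is $\mathbb{R}$ or $\mathbb{C}$; $S_X$ is the unit sphere of $X$. $X$ has property $(sO)$ (the net version of the Opial property) if for every non-zero $x\in X$ and every bounded weakly null net $(x_\alpha)\subset X$ one has $\limsup_\alpha\|x_\alpha\|<\limsup_\alpha\|x+x_\alpha\|$. For $x\in S_X$ and $t\ge 0$, $\bar{\delta}_X(x,t)=\sup_{\dim(X/Y)<\infty}\ \inf_{y\in Y,\ \|y\|\geq t}\|x+y\|-1$, where $Y$ ranges over the closed subspaces of $X$ of finite codimension. *)

(* Defs.v *)
From mathcomp Require Import all_boot all_order all_algebra.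
From mathcomp Require Export complex.
From mathcomp Require Import all_classical all_reals all_analysis.
Set Implicit Arguments.
Unset Strict Implicit.
Unset Printing Implicit Defensive.
Import Order.TTheory GRing.Theory Num.Theory.
Import numFieldNormedType.Exports.
Local Open Scope classical_set_scope.
Local Open Scope ring_scope.

(* The norm of a [normedModType K] takes its values in K.  For K = R[i] these
   values are nonnegative reals embedded in K, so the real-valued norm is
   [re `|x|], where [re : K -> R] is the identity for K = R and the real part
   for K = R[i]. *)

Section nets.
Variables (I : Type) (le : I -> I -> Prop).

Definition directed : Prop :=
  [/\ inhabited I, forall i, le i i,
      forall i j k, le i j -> le j k -> le i k &
      forall i j, exists k, le i k /\ le j k].

Definition tails : set_system I :=
  [set A | exists i, forall j, le i j -> A j].

Definition net_limsup (R : realType) (u : I -> R) : \bar R :=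
  ereal_inf [set ereal_sup [set (u j)%:E | j in [set j | le i j]]
            | i in [set: I]].

End nets.

Section banach.
Variables (R : realType) (K : numFieldType) (re : K -> R) (X : normedModType K).

Definition weakly_null (I : Type) (le : I -> I -> Prop) (u : I -> X) : Prop :=
  forall f : {linear X -> K^o}, continuous f -> f (u i) @[i --> tails le] --> 0.

Definition property_sO : Prop :=
  forall x : X, x != 0 ->
  forall (I : Type) (le : I -> I -> Prop) (u : I -> X),
    directed le -> bounded_set (range u) -> weakly_null le u ->
    (net_limsup le (fun i => re `|u i|%R) <
     net_limsup le (fun i => re `|x + u i|%R))%E.

(* The classes of the [e i] span the quotient X / Y. *)
Definition finite_codim (Y : set X) : Prop :=
  exists (n : nat) (e : 'I_n -> X), forall x : X,
    exists c : 'I_n -> K, Y (x - \sum_(i < n) c i *: e i).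

Definition finite_dim : Prop :=
  exists (n : nat) (e : 'I_n -> X), forall x : X,
    exists c : 'I_n -> K, x = \sum_(i < n) c i *: e i.

(* Extended-real valued, with inf set0 = +oo: in finite dimension Y = {0} is
   allowed and the value is +oo for t > 0; in infinite dimension the value is
   always finite. *)
Definition delta_bar (x : X) (t : R) : \bar R :=
  (ereal_sup
    [set ereal_inf [set (re `|x + y|%R)%:E
                   | y in [set y | Y y /\ (t <= re `|y|)%R]]
    | Y in [set Y : set X |
             [/\ submod_closed (mem Y), closed Y & finite_codim Y]]] - 1)%E.

End banach.

(* Main.v *)
From HB Require Import structures.
Require Import Defs.
From Stdlib Require List.
From mathcomp Require Import all_boot all_order all_algebra.
From mathcomp Require Import all_classical all_reals all_analysis.
From mathcomp Require Import lra.
Import Order.TTheory GRing.Theory Num.Theory.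
Import numFieldNormedType.Exports.
Local Open Scope classical_set_scope.
Local Open Scope ring_scope.

(** A finite dimensional space satisfies the condition on [delta_bar]
    trivially: for Y = {0} the infimum is over an empty set.  So the claim is
    that property (sO) is equivalent to [t - 1 < delta_bar x t] for all unit [x]
    and all [t >= 1], which by [delta_barP] says: on some closed subspace Y of
    finite codimension, [|x + y| >= t + eta] as soon as [|y| >= t], for some
    [eta > 0].

    From (sO) to the condition ([sO_delta_bar]).  If the condition fails at
    [x, t], every closed Y of finite codimension contains, for each n, some y
    with [|y| >= t] and [|x + y| < t + 1/(n+1)].  Choosing such a y in the
    common kernel of each finite list of continuous functionals gives a bounded
    net, which is weakly null because each functional eventually vanishes on it.
    Then [limsup |y| >= t >= limsup |x + y|], against (sO).

    From the condition to (sO) ([delta_bar_sO]).  Two facts are needed.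
    First, a weakly null net is asymptotically in any closed Y of finite
    codimension ([weakly_null_near_codim]): by [codim_functionals] there are
    continuous functionals [f i] and vectors [e i] such that
    [x - sum f i x *: e i] is always in Y, and the sum tends to 0 along the net.
    Second, the condition used at a single t controls all y in Y: scaling a
    shorter y up to norm t and using the triangle inequality gives
    [|x + y| >= min |y| t + eta] ([delta_bar_gain]).  Applying this to x / |x|
    with t at least [limsup |u| / |x|], and moving the net u into Y, one gets
    [limsup |x + u| > limsup |u|].

    Real and complex scalars are treated at once: the scalar field K is any
    complete field whose nonnegative elements are the images of nonnegative
    reals under an order embedding [iota], with retraction [re]. *)

(** * Closed subspaces of finite codimension *)

(** Stated for [K^o], whose uniform structure is the one given by the absolute
    value; completeness is what makes the sum of a closed subspace and a line
    closed. *)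
Definition complete_field (K : numFieldType) : Prop :=
  forall F : set_system K^o, ProperFilter F -> cauchy F -> cvg F.

Definition subspace {K : numFieldType} {X : lmodType K} (Y : set X) : Prop :=
  Y 0 /\ forall (a : K) u v, Y u -> Y v -> Y (a *: u + v).

Lemma subspaceP {K : numFieldType} {X : lmodType K} (Y : set X) :
  submod_closed (mem Y) <-> subspace Y.
Proof.
split=> -[Y0 Ylin]; split.
- by move: Y0; rewrite in_setE.
- by move=> a u v Yu Yv; have := Ylin a u v; rewrite !in_setE; apply.
- by rewrite in_setE.
- by move=> a u v; rewrite !in_setE; exact: Ylin.
Qed.

Section subspace_theory.
Context {K : numFieldType} {X : lmodType K} {Y : set X}.
Hypothesis sY : subspace Y.

Lemma subspace0 : Y 0. Proof. by case: sY. Qed.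

Lemma subspaceD u v : Y u -> Y v -> Y (u + v).
Proof. by move=> Yu Yv; rewrite -[u]scale1r; apply: sY.2. Qed.

Lemma subspaceZ a u : Y u -> Y (a *: u).
Proof.
by move=> Yu; rewrite -[_ *: _]addr0; apply: sY.2 => //; exact: subspace0.
Qed.

Lemma subspaceB u v : Y u -> Y v -> Y (u - v).
Proof.
by move=> Yu Yv; apply: subspaceD => //; rewrite -scaleN1r; exact: subspaceZ.
Qed.

Lemma subspace_add_line (e : X) :
  subspace [set z | exists a : K, Y (z - a *: e)].
Proof.
split=> /=; first by exists 0; rewrite scale0r subr0; exact: subspace0.
move=> a u v [b Yb] [c Yc]; exists (a * b + c).
rewrite scalerDl -scalerA opprD addrACA -scalerBr.
exact: sY.2.
Qed.

End subspace_theory.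

Section closed_subspaces.
Context {K : numFieldType} {X : normedModType K}.

(** A ball around [e] that misses Y has a radius d bounding from below the
    distance from [e] to Y; dividing z by the coefficient a scales this to the
    whole of Y + K e.  The coefficient along e is thus a bounded functional. *)
Lemma subspace_dist {Y : set X} {e : X} : subspace Y -> closed Y -> ~ Y e ->
  exists2 d : K, 0 < d & forall (a : K) z, Y (z - a *: e) -> `|a| * d <= `|z|.
Proof.
move=> sY cY Ye.
have /nbhs_normP[d d0 Bd] : nbhs e (~` Y).
  by apply: open_nbhs_nbhs; split=> //; rewrite openC.
exists d => // a z Yz.
have [->|a0] := eqVneq a 0; first by rewrite normr0 mul0r.
rewrite real_leNgt ?ger0_real ?mulr_ge0 ?(ltW d0)// ; apply/negP => zlt.
apply: (Bd (- a^-1 *: (z - a *: e))); last exact: subspaceZ.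
rewrite /ball_/= scaleNr opprK scalerBr scalerA mulVf// scale1r addrC subrK.
by rewrite normrZ normfV ltr_pdivrMl ?normr_gt0.
Qed.

(** Near a limit point z of Y + K e the coefficients along e form a Cauchy
    filter, since they depend on the point in a Lipschitz way; if a is their
    limit, then z - a e is a limit of points of Y. *)
Lemma closed_add_line {Y : set X} {e : X} : complete_field K ->
  subspace Y -> closed Y -> closed [set z | exists a : K, Y (z - a *: e)].
Proof.
move=> Kc sY cY.
have [Ye|Ye] := pselect (Y e).
  rewrite (_ : [set z | _] = Y)//; apply/seteqP; split=> z /=.
    by case=> a Yz; rewrite -[z](subrK (a *: e)); apply/(subspaceD sY)/subspaceZ.
  by move=> Yz; exists 0; rewrite scale0r subr0.
have [d d0 dP] := subspace_dist sY cY Ye.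
set Z := [set z | _]; move=> z clz.
have FF : ProperFilter (within Z (nbhs z)) by apply: within_nbhs_proper.
have [g gP] : exists g : X -> K^o, forall w, Z w -> Y (w - g w *: e).
  have gex w : exists a : K^o, Z w -> Y (w - a *: e).
    have [[a Ya]|nZ] := pselect (Z w); first by exists a.
    by exists 0.
  by have [g] := choice gex; exists g.
have gN v w : Z v -> Z w -> `|g v - g w| * d <= `|v - w|.
  move=> Zv Zw; apply: dP.
  rewrite (_ : _ - _ = (v - g v *: e) - (w - g w *: e)).
    by apply: (subspaceB sY); exact: gP.
  by rewrite scalerBl !opprD !opprK addrACA.
have near_z (eps : K) : 0 < eps ->
    (within Z (nbhs z)) [set v | Z v /\ `|z - v| < eps].
  by move=> eps0; apply/nbhs_normP; exists eps.
have gc : cauchy (g @ within Z (nbhs z)).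
  apply: (@cauchy_exP K K^o) => eps eps0.
  have e0 : 0 < eps * d / 2 by rewrite divr_gt0// mulr_gt0.
  have [w [Zw wz]] := filter_ex (near_z _ e0).
  exists (g w); apply: filterS (near_z _ e0) => v [Zv vz] /=.
  rewrite /ball/= -(ltr_pM2r d0); apply: le_lt_trans (gN _ _ Zw Zv) _.
  rewrite -(subrKA z) (le_lt_trans (ler_normD _ _))//.
  by rewrite [ltRHS]splitr ltrD// distrC.
have /cvg_ex[a ga] := Kc _ (fmap_proper_filter g FF) gc.
exists a; apply: (closed_cvg Y cY (F := within Z (nbhs z))
  (u_ := fun v => v - g v *: e)).
  by apply: filterS (near_z _ ltr01) => v [Zv _]; exact: gP.
apply: cvgB; first exact: cvg_within.
by apply: cvgZ; [exact: ga|exact: cvg_cst].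
Qed.

(** If f is not zero on Y, one more vector of Y, normalized so that f takes the
    value 1 there, corrects the value of f on the component along Y. *)
Lemma finite_codim_kernel {Y : set X} (f : {linear X -> K^o}) :
  subspace Y -> finite_codim Y -> finite_codim (Y `&` [set x | f x = 0]).
Proof.
move=> sY [n [e eP]].
have [[y [Yy fy]]|fY] := pselect (exists y, Y y /\ f y != 0); last first.
  exists n, e => x; have [c Yc] := eP x; exists c; split=> //=.
  by apply/eqP/negPn/negP => fc; apply: fY; exists (x - \sum_(i < n) c i *: e i).
exists n.+1, (fun i => if unlift ord0 i is Some j then e j else (f y)^-1 *: y).
move=> x; have [c Yc] := eP x; set z := x - _ in Yc.
exists (fun i => if unlift ord0 i is Some j then c j else f z).
rewrite big_ord_recl unlift_none.
under eq_bigr do rewrite liftK.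
rewrite opprD addrCA addrC -/z; split=> /=.
  by apply: (subspaceB sY) => //; do 2 apply: (subspaceZ sY).
by rewrite scalerA linearB linearZ /= [_ *: _](divfK fy) subrr.
Qed.

Definition functional : Type := {f : {linear X -> K^o} | continuous f}.

Definition common_kernel (l : seq functional) : set X :=
  [set x | forall f, List.In f l -> sval f x = 0].

Lemma common_kernel_subspace l : subspace (common_kernel l).
Proof.
split=> [f _|a u v u0 v0 f fl]; first exact: linear0.
by rewrite linearP u0// v0// scaler0 addr0.
Qed.

Lemma common_kernel_closed l : closed (common_kernel l).
Proof.
rewrite (_ : common_kernel l =
    \bigcap_(f in [set f | List.In f l]) (sval f @^-1` [set (0 : K^o)])) //.
apply: closed_bigI => f _.
move/continuous_closedP: (svalP f); apply.
apply: accessible_closed_set1; apply: hausdorff_accessible.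
exact: norm_hausdorff.
Qed.

Lemma common_kernel_codim l : finite_codim (common_kernel l).
Proof.
elim: l => [|f l IHl].
  by exists 0%N, (fun=> 0) => x; exists (fun=> 0).
have := finite_codim_kernel (sval f) (common_kernel_subspace l) IHl.
congr (finite_codim _); apply/seteqP; split=> x /=.
  by move=> [xl xf] g /= [<-//|]; exact: xl.
by move=> xl; split; [move=> g gl|]; apply: xl; [right|left].
Qed.

Lemma cvg_sum_scale (T : Type) (F : set_system T) (n : nat) (e : 'I_n -> X)
    (f : 'I_n -> T -> K^o) (a : 'I_n -> K) : Filter F ->
  (forall i, f i t @[t --> F] --> (a i : K^o)) ->
  \sum_i f i t *: e i @[t --> F] --> \sum_i a i *: e i.
Proof.
move=> FF fa; apply: cvg_big; first exact: add_continuous.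
by move=> i _; apply: cvgZ; [exact: fa|exact: cvg_cst].
Qed.

(** Coordinates modulo Y can be chosen continuous.  Modulo the closed subspace
    Z = Y + K e_0 one vector fewer spans X, so induction gives a continuous
    linear P from X to Z; the coordinate of x along e_0 is that of P x, and it
    is continuous by [subspace_dist] if e_0 is not in Y.  If e_0 lies in Y,
    then Z = Y and the coordinate is zero. *)
Lemma codim_functionals (n : nat) (Y : set X) (e : 'I_n -> X) :
  complete_field K -> subspace Y -> closed Y ->
  (forall x, exists c : 'I_n -> K, Y (x - \sum_i c i *: e i)) ->
  exists f : 'I_n -> {linear X -> K^o},
    (forall i, continuous (f i)) /\ forall x, Y (x - \sum_i f i x *: e i).
Proof.
move=> Kc; elim: n Y e => [|n IHn] Y e sY cY Yspan.
  exists (fun=> \0); split=> [[]//|x].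
  by have [c] := Yspan x; rewrite !big_ord0.
have [|||f [fc fP]] := IHn [set z | exists a : K, Y (z - a *: e ord0)]
  (fun i => e (lift ord0 i)).
- exact: subspace_add_line.
- exact: closed_add_line.
- move=> x; have [c] := Yspan x; rewrite big_ord_recl => Yc.
  exists (c \o lift ord0) => /=; exists (c ord0).
  by rewrite -addrA -opprD [X in _ - X]addrC.
suff [g [gc gP]] : exists g : {linear X -> K^o}, continuous g /\
    forall x, Y (x - \sum_(i < n) f i x *: e (lift ord0 i) - g x *: e ord0).
  exists (fun i => if unlift ord0 i is Some j then f j else g); split=> [i|x].
    by case: unliftP.
  rewrite big_ord_recl unlift_none.
  under eq_bigr do rewrite liftK.
  by rewrite opprD addrCA addrC; exact: gP.
have [Ye|Ye] := pselect (Y (e ord0)).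
  exists \0; split=> [x|x]; first exact: cvg_cst.
  have [a Ya] := fP x; rewrite scale0r subr0.
  by rewrite -[X in Y X](subrK (a *: e ord0)); apply/(subspaceD sY)/subspaceZ.
have [d d0 dP] := subspace_dist sY cY Ye.
have [g gP] := choice fP.
set P := fun x : X => x - \sum_(i < n) f i x *: e (lift ord0 i).
have uniq z z' a a' : Y (z - a *: e ord0) -> Y (z' - a' *: e ord0) ->
    `|a - a'| * d <= `|z - z'|.
  move=> Yz Yz'; apply: dP.
  rewrite (_ : _ - _ = (z - a *: e ord0) - (z' - a' *: e ord0)).
    exact: (subspaceB sY).
  by rewrite scalerBl !opprD !opprK addrACA.
have Plin (a : K) x y : P (a *: x + y) = a *: P x + P y.
  rewrite /P scalerBr addrACA -opprD scaler_sumr -big_split/=.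
  by congr (_ - _); apply: eq_bigr => i _; rewrite linearP scalerDl scalerA.
have glin : linear (g : X -> K^o).
  move=> a x y; apply/eqP; rewrite -subr_eq0 -normr_le0 -(pmulr_lle0 _ d0).
  apply: le_trans (uniq (P (a *: x + y)) (a *: P x + P y) _ _ (gP _) _) _.
    rewrite scalerDl opprD addrACA -scalerA -scalerBr.
    by apply: sY.2; exact: gP.
  by rewrite Plin subrr normr0.
have Pc : continuous P.
  move=> x; apply: cvgB; first exact: cvg_id.
  by apply: cvg_sum_scale => i; exact: fc.
exists (HB.pack_for {linear X -> K^o} (g : X -> K^o)
  (GRing.isLinear.Build _ _ _ _ (g : X -> K^o) glin)); split=> [x /=|//].
apply/(@cvgrPdist_lt _ K^o) => eps eps0.
apply: filterS (cvgr_dist_lt P (P x) (Pc x) (eps * d) (mulr_gt0 eps0 d0)).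
move=> y Pxy; rewrite -(ltr_pM2r d0); apply: le_lt_trans Pxy.
by apply: uniq; exact: gP.
Qed.

End closed_subspaces.

(** * Superior limits along nets *)

Section nets.
Context {R : realType} {I : Type} (le : I -> I -> Prop).

Lemma tails_filter : directed le -> Filter (tails le).
Proof.
move=> [[i0] refl trans dir]; split.
- by exists i0.
- move=> A B [i Ai] [j Bj]; have [k [ik jk]] := dir i j.
  exists k => l kl; split; [apply: Ai|apply: Bj].
    exact: trans kl.
  exact: trans kl.
- by move=> A B AB [i Ai]; exists i => j /Ai /AB.
Qed.

Lemma net_limsup_le (u : I -> R) (c : R) (i : I) :
  (forall j, le i j -> u j <= c) -> (net_limsup le u <= c%:E)%E.
Proof.
move=> uc; apply: (@le_trans _ _
  (ereal_sup [set (u j)%:E | j in [set j | le i j]])).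
  by apply: ereal_inf_lbound; exists i.
by apply: ge_ereal_sup => _ [j ij <-]; rewrite lee_fin; exact: uc.
Qed.

Lemma net_limsup_ge (u : I -> R) (c : R) :
  (forall i, exists2 j, le i j & c <= u j) -> (c%:E <= net_limsup le u)%E.
Proof.
move=> uc; apply: le_ereal_inf_tmp => _ [i _ <-].
have [j ij cj] := uc i.
apply: (@le_trans _ _ (u j)%:E); first by rewrite lee_fin.
by apply: ereal_sup_ubound; exists j.
Qed.

Lemma net_limsup_frequently (u : I -> R) (c : R) (i : I) :
  (c%:E < net_limsup le u)%E -> exists2 j, le i j & c < u j.
Proof.
move=> cu.
have : (c%:E < ereal_sup [set (u j)%:E | j in [set j | le i j]])%E.
  by apply: lt_le_trans cu _; apply: ereal_inf_lbound; exists i.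
by move=> /ereal_sup_gt[_ [j ij <-]]; rewrite lte_fin; exists j.
Qed.

End nets.

(** * The Opial property and the modulus *)

Section opial.
Context {R : realType} {K : numFieldType}.
Context (re : K -> R) (iota : {rmorphism R -> K}).
Hypothesis Kc : complete_field K.
Hypothesis iotaK : forall k : K, 0 <= k -> iota (re k) = k.
Hypothesis ler_iota : forall a b : R, (iota a <= iota b) = (a <= b).
Context {X : normedModType K}.
Implicit Types (x y : X) (a : R).

Local Notation N x := (re `|x|).

Let iotaN x : iota (N x) = `|x|. Proof. exact: iotaK. Qed.

Let ltr_iota a b : (iota a < iota b) = (a < b).
Proof. by rewrite !lt_neqAle ler_iota fmorph_eq. Qed.

Let N_ge0 x : 0 <= N x. Proof. by rewrite -ler_iota rmorph0 iotaN. Qed.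

Let iota_real a : iota a \is Num.real.
Proof. by rewrite realE -(rmorph0 iota) !ler_iota le_total. Qed.

Let N_D x y : N (x + y) <= N x + N y.
Proof. by rewrite -ler_iota rmorphD !iotaN ler_normD. Qed.

Let N_N x : N (- x) = N x. Proof. by rewrite normrN. Qed.

Let N_Z a x : 0 <= a -> N (iota a *: x) = a * N x.
Proof.
move=> a0; apply: (fmorph_inj iota).
by rewrite iotaN normrZ rmorphM/= iotaN ger0_norm// -(rmorph0 iota) ler_iota.
Qed.

Let N_eq0 x : (N x == 0) = (x == 0).
Proof. by rewrite -(fmorph_eq iota) iotaN rmorph0 normr_eq0. Qed.

Let N_B x y : N x - N y <= N (x + y).
Proof. by rewrite lerBlDr -(N_N y) -{1}[x](addrK y) N_D. Qed.

Lemma delta_barP (x : X) (t : R) : ((t - 1)%:E < delta_bar re x t)%E <->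
  exists Y : set X, [/\ subspace Y, closed Y, finite_codim Y &
    exists2 eta : R, 0 < eta &
      forall y, Y y -> t <= N y -> t + eta <= N (x + y)].
Proof.
rewrite /delta_bar EFinB lteBrDr// subeK//; split.
  move=> /ereal_sup_gt[_ [Y [/subspaceP sY cY fY] <-] tinf].
  exists Y; split => //.
  have [b tb binf] : exists2 b : R, t < b & (b%:E <=
      ereal_inf [set (N (x + y))%:E | y in [set y | Y y /\ (t <= N y)%R]])%E.
    move: tinf; case: ereal_inf => [b| |]//.
      by rewrite lte_fin => tb; exists b.
    by exists (t + 1); rewrite ?ltrDl// leey.
  exists (b - t); first by rewrite subr_gt0.
  move=> y Yy ty; rewrite addrC subrK -lee_fin; apply: le_trans binf _.
  by apply: ereal_inf_lbound; exists y.
move=> [Y [sY cY fY [eta eta0 etaP]]].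
apply: (@lt_le_trans _ _ (t + eta)%:E); first by rewrite lte_fin ltrDl.
apply: le_trans (ereal_sup_ubound _); last first.
  by exists Y => //; split => //; exact/subspaceP.
by apply: le_ereal_inf_tmp => _ [y [Yy ty] <-]; rewrite lee_fin; exact: etaP.
Qed.

Lemma finite_dim_delta_bar (x : X) (t : R) : finite_dim X -> 0 < t ->
  ((t - 1)%:E < delta_bar re x t)%E.
Proof.
move=> [n [e eP]] t0; apply/delta_barP; exists [set 0]; split.
- split=> //= a u v -> ->; by rewrite scaler0 addr0.
- apply: accessible_closed_set1; apply: hausdorff_accessible.
  exact: norm_hausdorff.
- by exists n, e => y; have [c ->] := eP y; exists c; rewrite subrr.
- by exists 1 => // y ->; rewrite leNgt (eqP (_ : N 0 == 0)) ?t0// N_eq0.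
Qed.

(** Indexing the contradicting net by lists of functionals rather than by
    subspaces makes directedness immediate, by concatenation, and common kernels
    are enough to make the net weakly null. *)
Lemma sO_delta_bar (x : X) (t : R) : property_sO re X -> x != 0 ->
  ((t - 1)%:E < delta_bar re x t)%E.
Proof.
move=> sO x0; apply/delta_barP; apply: contrapT => nY.
have uex (i : seq (@functional K X) * nat) : exists y,
    [/\ common_kernel i.1 y, t <= N y & N (x + y) < t + i.2.+1%:R^-1].
  apply: contrapT => ny; apply: nY; exists (common_kernel i.1); split.
  - exact: common_kernel_subspace.
  - exact: common_kernel_closed.
  - exact: common_kernel_codim.
  - exists i.2.+1%:R^-1; first by rewrite invr_gt0.
    move=> y ky ty; rewrite leNgt; apply/negP => xy.
    by apply: ny; exists y.
have [u uP] := choice uex.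
pose le (i j : seq (@functional K X) * nat) :=
  (forall f, List.In f i.1 -> List.In f j.1) /\ (i.2 <= j.2)%N.
have dle : directed le.
  split.
  - apply: inhabits; exact: ([::], 0%N).
  - by move=> i; split.
  - move=> i j k [ij1 ij2] [jk1 jk2]; split; last exact: leq_trans jk2.
    by move=> f /ij1/jk1.
  - move=> i j; exists ((i.1 ++ j.1)%SEQ, maxn i.2 j.2).
    split; split=> /=; rewrite ?leq_maxl ?leq_maxr// => f fi;
      by apply: List.in_or_app; tauto.
have := sO x x0 _ le u dle _ _; rewrite ltNge => /(_ _ _)/negP; apply.
(* Boundedness: |u| <= |x + u| + |x| and |x + u| < t + 1. *)
- exists (iota (t + 1 + N x)); split; first exact: iota_real.
  move=> M NM _ /= [i _ <-]; apply: le_trans (ltW NM).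
  rewrite -(iotaN (u i)) ler_iota -[u i](addKr x).
  have [_ _ xu] := uP i; apply: le_trans (N_D _ _) _; rewrite N_N addrC lerD2r.
  apply: ltW (lt_le_trans xu _).
  by rewrite lerD2l invf_le1 ?ltr0n// ler1n.
(* Any list that contains f is followed by values of the net in its kernel. *)
- move=> f fc A /nbhs_singleton A0.
  exists ([:: exist _ f fc], 0%N) => j [fj _] /=.
  have [uj _ _] := uP j.
  by rewrite (uj _ (fj _ (or_introl erefl))).
- apply: (@le_trans _ _ t%:E); last first.
    by apply: net_limsup_ge => i; exists i; [split|have [] := uP i].
  apply/lee_addgt0Pr => e e0.
  have [n ne] := ltr_add_invr e0.
  rewrite -EFinD; apply: (net_limsup_le _ _ _ ([::], n)) => j [_ nj].
  have [_ _ /ltW/le_trans] := uP j; apply.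
  rewrite lerD2l; apply: le_trans (ltW ne).
  rewrite add0r lef_pV2 ?posrE// ler_nat.
  exact: leq_ltn_trans nj _.
Qed.

Lemma weakly_null_near_codim (I : Type) (le : I -> I -> Prop) (u : I -> X)
    (Y : set X) (eps : R) :
  directed le -> weakly_null le u -> subspace Y -> closed Y -> finite_codim Y ->
  0 < eps -> exists i, forall j, le i j -> exists2 v, Y v & N (u j - v) < eps.
Proof.
move=> dle u0 sY cY [n [e eP]] eps0.
have [f [fc fP]] := codim_functionals n Y e Kc sY cY eP.
have FF := tails_filter le dle.
have s0 := cvg_sum_scale I (tails le) n e (fun i j => f i (u j)) (fun=> 0) FF
  (fun i => u0 (f i) (fc i)).
rewrite [X in _ --> X]big1 in s0; last by move=> i _; rewrite scale0r.
have ieps : 0 < iota eps by rewrite -(rmorph0 iota) ltr_iota.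
have [i iP] := cvgr0_norm_lt _ s0 _ ieps.
exists i => j /iP Nj; exists (u j - \sum_i f i (u j) *: e i); first exact: fP.
by rewrite opprB addrC subrK -ltr_iota iotaN.
Qed.

(** The hypothesis is used only at x' = x / |x| and t = max (T / |x|) 1.  For a
    nonzero y shorter than t, put r = t / |y|: then
    |x' + y| >= |x' + r y| - (r - 1) |y| >= (t + eta) - (t - |y|).
    The gain is capped by 1, the value of |x' + y| - |y| at y = 0, where no
    scaling is possible.  Multiplying by |x| gives the claim for x and T. *)
Lemma delta_bar_gain (x : X) (T : R) : x != 0 ->
  (forall (t : R) x, 1 <= t -> `|x| = 1 -> ((t - 1)%:E < delta_bar re x t)%E) ->
  exists Y : set X, [/\ subspace Y, closed Y, finite_codim Y &
    exists2 h : R, 0 < h & forall y, Y y -> Order.min (N y) T + h <= N (x + y)].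
Proof.
move=> x0 dX; set a := N x.
have a0 : 0 < a by rewrite lt_neqAle eq_sym N_eq0 x0 N_ge0.
have iota_a : iota a = `|x| by exact: iotaN.
set t := Order.max (T / a) 1.
have t1 : 1 <= t by rewrite le_max lexx orbT.
have Nx' : `|iota a^-1 *: x| = 1.
  rewrite normrZ ger0_norm; last first.
    by rewrite -(rmorph0 iota) ler_iota invr_ge0 ltW.
  by rewrite -iota_a -rmorphM mulVf ?gt_eqF// rmorph1.
have /delta_barP[Y [sY cY fY [eta eta0 etaP]]] := dX t _ t1 Nx'.
exists Y; split => //; exists (a * Order.min eta 1).
  by rewrite mulr_gt0// lt_min eta0 ltr01.
set x' := iota a^-1 *: x in Nx' etaP.
have {}Nx' : N x' = 1 by apply: (fmorph_inj iota); rewrite iotaN Nx' rmorph1.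
have gain y : Y y -> Order.min (N y) t + Order.min eta 1 <= N (x' + y).
  move=> Yy; have [ty|yt] := leP t (N y).
    by apply: le_trans (etaP _ Yy ty); rewrite lerD2l ge_min lexx.
  have [->|y0] := eqVneq y 0.
    by rewrite addr0 Nx' (eqP (_ : N 0 == 0)) ?N_eq0// add0r ge_min lexx orbT.
  have Ny0 : 0 < N y by rewrite lt_neqAle eq_sym N_eq0 y0 N_ge0.
  set r := t / N y.
  have r1 : 1 <= r by rewrite ler_pdivlMr// mul1r ltW.
  have Nry : N (iota r *: y) = t.
    by rewrite N_Z ?(le_trans ler01)// divfK ?gt_eqF.
  have := etaP (iota r *: y) (subspaceZ sY _ _ Yy); rewrite Nry lexx => /(_ isT).
  have -> : x' + iota r *: y = (x' + y) + iota (r - 1) *: y.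
    by rewrite rmorphB rmorph1 scalerBl scale1r -addrA [y + _]addrC subrK.
  move=> /le_trans /(_ (N_D _ _)).
  rewrite N_Z ?subr_ge0// mulrBl mul1r divfK ?gt_eqF//.
  have : Order.min eta 1 <= eta by rewrite ge_min lexx.
  lra.
move=> y Yy; have := gain _ (subspaceZ sY (iota a^-1) _ Yy).
rewrite -scalerDr !N_Z ?invr_ge0 ?(ltW a0)//.
rewrite -(ler_pM2l a0) mulVKf ?gt_eqF// mulrDr; apply: le_trans.
rewrite lerD2r minr_pMr ?(ltW a0)// mulVKf ?gt_eqF// le_min ge_min lexx/=.
rewrite ge_min; apply/orP; right.
by rewrite mulrC -ler_pdivrMr// le_max lexx.
Qed.

(** Take L = limsup |u| and a frequent index where |u| > L - h / 8 and u is
    within h / 8 of some v in Y.  Passing from u to v and from x + v back to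
    x + u costs h / 8 each, so at least h / 2 of the gain h is left. *)
Lemma delta_bar_sO :
  (forall (t : R) x, 1 <= t -> `|x| = 1 -> ((t - 1)%:E < delta_bar re x t)%E) ->
  property_sO re X.
Proof.
move=> dX x x0 I le u dle bu u0.
have [[i0] refl trans dir] := dle.
have [r r0 ur] : exists2 r : K, 0 < r & forall i, `|u i| <= r.
  by have /pinfty_ex_gt0[r r0 ru] := bu; exists r => // i; apply: ru; exists i.
have {ur} uM i : N (u i) <= re r by rewrite -ler_iota (iotaK _ (ltW r0)) iotaN.
have Lu : (net_limsup le (fun i => N (u i)) <= (re r)%:E)%E.
  by apply: (net_limsup_le _ _ _ i0) => j _.
have L0 : (0%:E <= net_limsup le (fun i => N (u i)))%E.
  by apply: net_limsup_ge => i; exists i => //; exact: refl.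
case EL : net_limsup Lu L0 => [L| |]// _ _.
have [Y [sY cY fY [h h0 hP]]] := delta_bar_gain x L x0 dX.
have d0 : 0 < h / 8 by rewrite divr_gt0.
have [k kP] := weakly_null_near_codim I le u Y (h / 8) dle u0 sY cY fY d0.
apply: (@lt_le_trans _ _ (L + h / 2)%:E); first by rewrite lte_fin; lra.
apply: net_limsup_ge => i.
have [m [im km]] := dir i k.
have [j mj Lj] : exists2 j, le m j & L - h / 8 < N (u j).
  by apply: net_limsup_frequently; rewrite EL lte_fin; lra.
exists j; first exact: trans mj.
have [v Yv uv] := kP j (trans _ _ _ km mj).
have := hP v Yv.
have Nv : N (u j) - N (u j - v) <= N v.
  by rewrite -[in leRHS](subKr (u j) v) -[N (u j - v)]N_N; exact: N_B.
have Nxv : N (x + v) - N (u j - v) <= N (x + u j).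
  by have := N_B (x + v) (u j - v); rewrite -addrA [v + _]addrC subrK.
have [Lv|vL] := leP (N v) L; lra.
Qed.

End opial.

(** * Real and complex scalars *)

Lemma complete_field_real (R : realType) : complete_field R.
Proof. by move=> F FF Fc; exact: (@cauchy_cvg R^o). Qed.

Section complex_scalars.
Context {R : realType}.
Implicit Types (z : R[i]) (a b : R).

Lemma ler_Re_norm z : `|complex.Re z| <= complex.Re `|z|.
Proof.
by case: z => a b; rewrite normc_def/= -sqrtr_sqr ler_wsqrtr// lerDl sqr_ge0.
Qed.

Lemma ler_Im_norm z : `|complex.Im z| <= complex.Re `|z|.
Proof.
by case: z => a b; rewrite normc_def/= -sqrtr_sqr ler_wsqrtr// lerDr sqr_ge0.
Qed.

Lemma ler_norm_ReIm z :
  complex.Re `|z| <= `|complex.Re z| + `|complex.Im z|.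
Proof.
case: z => a b; rewrite normc_def/= -(ler_pXn2r (n := 2))// ?nnegrE ?addr_ge0//.
rewrite sqr_sqrtr ?addr_ge0 ?sqr_ge0// sqrrD !real_normK ?num_real//.
by rewrite lerD2r lerDl mulrn_wge0// mulr_ge0.
Qed.

Lemma complex_ge0E z : 0 <= z -> (complex.Re z)%:C%C = z.
Proof. by move=> z0; apply: RRe_real; exact: ger0_real. Qed.

(** Real and imaginary parts are 1-Lipschitz, so they send a Cauchy filter to
    Cauchy filters of reals; the limits are the parts of the limit. *)
Lemma complete_field_complex : complete_field R[i].
Proof.
move=> F FF /(@cauchyP _ R[i]^o) Fc.
have part (p : R[i] -> R) : (forall z w, p z - p w = p (z - w)) ->
    (forall z, `|p z| <= complex.Re `|z|) -> exists a : R, p @ F --> a.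
  move=> pB pN; apply/cvg_ex; apply: (@cauchy_cvg R^o).
  apply: cauchy_exP => e e0.
  have [|z Fz] := Fc (e%:C%C); first by rewrite ltcR.
  exists (p z); apply: (@filterS _ F _ _ _ _ Fz) => w.
  rewrite /ball/= -[`|z - w|]complex_ge0E// ltcR pB; exact: le_lt_trans.
have [|a Fa] := part (@complex.Re R) _ ler_Re_norm; first by move=> [? ?] [].
have [|b Fb] := part (@complex.Im R) _ ler_Im_norm; first by move=> [? ?] [].
apply/cvg_ex; exists (a +i* b)%C; apply/(@cvgrPdist_lt _ R[i]^o) => e e0.
have e2 : 0 < complex.Re e / 2.
  by rewrite divr_gt0// -ltcR complex_ge0E// ltW.
near=> z.
rewrite -[`|_|]complex_ge0E// -[e]complex_ge0E ?ltW// ltcR.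
apply: le_lt_trans (ler_norm_ReIm _) _; rewrite [ltRHS]splitr ltrD//.
- have -> : complex.Re ((a +i* b)%C - z) = a - complex.Re z by case: (z).
  by near: z; exact: cvgr_dist_lt Fa _ e2.
- have -> : complex.Im ((a +i* b)%C - z) = b - complex.Im z by case: (z).
  by near: z; exact: cvgr_dist_lt Fb _ e2.
Unshelve. all: by end_near. Qed.

End complex_scalars.

Lemma property_sO_iff {R : realType} {K : numFieldType} (re : K -> R)
    (iota : {rmorphism R -> K}) (X : normedModType K) :
  complete_field K -> (forall k : K, 0 <= k -> iota (re k) = k) ->
  (forall a b : R, (iota a <= iota b) = (a <= b)) ->
  property_sO re X <->
  (finite_dim X \/
   forall (t : R) (x : X), 1 <= t -> `|x| = 1 ->
     ((t - 1)%:E < delta_bar re x t)%E).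
Proof.
move=> Kc iotaK ler_iota; split=> [sO|[fX|dX]].
- right=> t x _ x1; apply: (sO_delta_bar re iota) => //.
  by rewrite -normr_eq0 x1 oner_eq0.
- apply: (delta_bar_sO re iota) => // t x t1 _.
  by apply: (finite_dim_delta_bar re iota) => //; apply: lt_le_trans t1.
- exact: (delta_bar_sO re iota).
Qed.

Theorem proposition5p4 (R : realType) :
  (forall X : completeNormedModType R,
     property_sO (@id R) X <->
     (finite_dim X \/
      forall (t : R) (x : X), 1 <= t -> `|x| = 1 ->
        ((t - 1)%:E < delta_bar (@id R) x t)%E))
  /\
  (forall X : completeNormedModType R[i],
     property_sO (@complex.Re R) X <->
     (finite_dim X \/
      forall (t : R) (x : X), 1 <= t -> `|x| = 1 ->
        ((t - 1)%:E < delta_bar (@complex.Re R) x t)%E)).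
Proof.
split=> X.
- apply: (property_sO_iff (@id R) (idfun : {rmorphism R -> R})) => //.
  exact: complete_field_real.
- apply: (property_sO_iff (@complex.Re R)
    (real_complex R : {rmorphism R -> R[i]})).
  + exact: complete_field_complex.
  + exact: complex_ge0E.
  + exact: lecR.
Qed.
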